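(* Let $n$ be a nonnegative integer. Then there is an extremal overlap-free word of length $n$ over the alphabet $\Sigma_2=\{\mathtt{0},\mathtt{1}\}$ if and only if $$n\in\{10,12\}\cup\{2k \colon k\geq 10\} \cup \{2^k+1 \colon k \geq 5\} \cup \{3\cdot 2^k + 1 \colon k \geq 3\}.$$
   Context: An overlap is a word of the form $axaxa$ with $a$ a letter and $x$ a possibly empty word; a word is overlap-free if it has no factor that is an overlap. For a word $w$ over an alphabet $\Sigma$, an extension of $w$ is a word $w'aw''$ with $a\in\Sigma$ and $w'w''=w$ ($w',w''$ possibly empty). A word $w$ is extremal overlap-free if $w$ is overlap-free and every extension of $w$ (over the same alphabet) contains an overlap. *)

(* Defs.v *)
From mathcomp Require Import all_boot.

Set Implicit Arguments.
Unset Strict Implicit.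
Unset Printing Implicit Defensive.

Section Words.

Variable Sigma : eqType.
Implicit Types (a : Sigma) (u v w x : seq Sigma).

Definition overlap v : Prop :=
  exists a x, v = [:: a] ++ x ++ [:: a] ++ x ++ [:: a].

(* [infix v w] is the library's "v is a factor (contiguous subword) of w". *)
Definition contains_overlap w : Prop :=
  exists2 v, infix v w & overlap v.

Definition overlap_free w : Prop := ~ contains_overlap w.

Definition extension w v : Prop :=
  exists a w' w'', w' ++ w'' = w /\ v = w' ++ [:: a] ++ w''.

Definition extremal_overlap_free w : Prop :=
  overlap_free w /\ forall v, extension w v -> contains_overlap v.

End Words.

(* The letters 0 and 1 are [false] and [true], as in the coercion
   [nat_of_bool]; thus words over Sigma2 are the library's [bitseq]. *)
Definition Sigma2 : eqType := bool.

(* Main.v *)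
Require Import Defs.
From mathcomp Require Import all_boot zify.

(* Let mu be the Thue-Morse morphism a |-> a (~~ a).  It preserves
   overlap-freeness, and conversely a long overlap-free word is, up to two letters
   at each end, an image under mu.  An insertion far from the ends breaks this
   pairing of the letters and creates a short overlap, so extremality only depends
   on the two ends.

   If a long extremal word w has odd length, then at one end the pairing leaves a
   single letter over.  Completing it to a block must create an overlap, and moving
   this overlap one letter inwards contradicts overlap-freeness of w unless it has
   length |w|; hence w is a letter next to an overlap-free square.  Desubstituting
   mu shows that such a square has period 2^k or 3 * 2^k.

   Conversely, if Y is overlap-free and both Y and its reversal start with
   a a (~~ a) a, then flipping the first and the last letter of mu(Y) gives an
   extremal word of length 2|Y|.  Such Y are built recursively, with length
   roughly halved at each step, for every length except powers of two.  The
   lengths 2^k, 2^k + 1 and 3 * 2^k + 1 come from squares in the periodic words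
   mu^k(0^omega) and mu^k((011)^omega), for the last two with the first letter
   flipped. *)

Set Implicit Arguments.
Unset Strict Implicit.
Unset Printing Implicit Defensive.

Implicit Types (a b : bool) (u v w Y : bitseq) (f g : nat -> bool).

(** * A decision procedure for overlaps *)

(** Here [p] is the length of [ax] in [axaxa]. Functions rather than words allow infinite sequences
    as well. *)
Definition overlap_at f s p := forall i, i <= p -> f (s + i) = f (s + p + i).

Fixpoint agree n u v : bool :=
  if n is n'.+1 then
    match u, v with
    | a :: u', b :: v' => (a == b) && agree n' u' v'
    | _, _ => false
    end
  else true.

(** For even [size w] the last candidate period is one too large; [agree] rejects it by running out
    of letters. *)
Definition overlap_prefix w : bool :=
  has (fun p => agree p.+1 w (drop p w)) (iota 1 (size w)./2).

Fixpoint has_overlap w : bool :=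
  if w is _ :: w' then overlap_prefix w || has_overlap w' else false.

Lemma agreeP n u v :
  reflect [/\ n <= size u, n <= size v &
              forall i, i < n -> nth false u i = nth false v i]
          (agree n u v).
Proof.
elim: n u v => [|n IHn] u v; first by constructor.
case: u v => [|a u] [|b v] /=; try by constructor; case.
apply: (iffP andP) => [[/eqP -> /IHn [Hu Hv H]]|[Hu Hv H]].
  by split=> // -[|i] //= /H.
split; first by apply/eqP; exact: (H 0).
by apply/IHn; split=> // i Hi; exact: (H i.+1).
Qed.

Lemma overlap_prefixP w :
  reflect (exists p, [/\ 0 < p, 2 * p < size w & overlap_at (nth false w) 0 p])
          (overlap_prefix w).
Proof.
apply: (iffP hasP) => [[p]|[p [p0 pw H]]].
  rewrite mem_iota => Hp /agreeP [_]; rewrite size_drop => Hs H.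
  exists p; split; [lia|lia|] => i Hi.
  by rewrite !add0n H // nth_drop.
exists p; first by rewrite mem_iota; lia.
apply/agreeP; rewrite size_drop; split; [lia|lia|] => i Hi.
by rewrite nth_drop; exact: (H i).
Qed.

Lemma has_overlapP w :
  reflect (exists s p, [/\ 0 < p, s + 2 * p < size w &
                           overlap_at (nth false w) s p])
          (has_overlap w).
Proof.
elim: w => [|a w IHw]; first by constructor=> -[s [p [_ /=]]]; lia.
rewrite /=; apply: (iffP orP) => [[/overlap_prefixP [p [p0 pw H]]|/IHw]|].
- by exists 0, p.
- by case=> s [p [p0 pw H]]; exists s.+1, p; split.
case=> -[|s] [p [p0 pw H]]; first by left; apply/overlap_prefixP; exists p.
by right; apply/IHw; exists s, p; split.
Qed.

Lemma nth_catD u v i : nth false (u ++ v) (size u + i) = nth false v i.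
Proof. by rewrite nth_cat ltnNge leq_addr addKn. Qed.

Lemma contains_overlapE w : contains_overlap w <-> has_overlap w.
Proof.
split=> [[_ /infixP [w1 [w2 ->]] [a [x ->]]]|/has_overlapP [s [p [p0 pw H]]]].
  have [u [u0 nu ->]] : exists u, [/\ 0 < size u, nth false u 0 = a &
      w1 ++ ([:: a] ++ x ++ [:: a] ++ x ++ [:: a]) ++ w2 = w1 ++ u ++ u ++ a :: w2].
    by exists (a :: x); split; rewrite /= -?catA //= -!catA.
  apply/has_overlapP; exists (size w1), (size u).
  split=> // [|i Hi]; first by rewrite !size_cat /=; lia.
  rewrite -addnA !nth_catD nth_cat; case: ltnP => ui; first by rewrite nth_cat ui.
  have -> : i = size u by lia.
  by rewrite subnn !nth_cat u0 ltnn subnn /= nu.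
set v := take (2 * p).+1 (drop s w); exists v.
  apply/infixP; exists (take s w), (drop (2 * p).+1 (drop s w)).
  by rewrite !cat_take_drop.
have sv : size v = (2 * p).+1 by rewrite size_take size_drop; case: ltnP; lia.
have nv i : i < (2 * p).+1 -> nth false v i = nth false w (s + i).
  by move=> Hi; rewrite nth_take // nth_drop.
have Hv i : i <= p -> nth false v i = nth false v (p + i).
  by move=> Hi; rewrite !nv ?[LHS]H ?addnA //; lia.
(* The period makes [v] two copies of [take p v] followed by its first letter, so [take p v] is the
   [ax] of [axaxa]. *)
have e1 : drop p v = take p v ++ [:: nth false v 0].
  apply: (@eq_from_nth _ false).
    by rewrite size_cat size_drop size_take sv /=; case: ltnP; lia.
  move=> i; rewrite size_drop sv => Hi.
  rewrite nth_drop -Hv; last by lia.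
  rewrite nth_cat size_take sv (_ : p < _ = true); last by lia.
  case: ltnP => Hip; first by rewrite nth_take.
  have -> : i = p by lia.
  by rewrite subnn /= -[p in LHS]addn0 -Hv.
have e2 : take p v = nth false v 0 :: behead (take p v).
  have sp : size (take p v) = p by rewrite size_takel // sv; lia.
  by rewrite -(nth_take _ p0); case: (take p v) sp => //= /esym; lia.
exists (nth false v 0), (behead (take p v)).
by rewrite -{1}(cat_take_drop p v) e1 e2.
Qed.

Lemma overlap_freeE w : overlap_free w <-> ~~ has_overlap w.
Proof.
rewrite /overlap_free; split=> [H|/negP H]; first by apply/negP => /contains_overlapE.
by move=> /contains_overlapE.
Qed.

Lemma has_overlap_cat u v w : has_overlap v -> has_overlap (u ++ v ++ w).
Proof.
case/has_overlapP => s [p [p0 pv H]]; apply/has_overlapP.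
exists (size u + s), p; split; rewrite ?size_cat //; first by lia.
move=> i Hi; rewrite -!addnA !nth_catD !nth_cat.
have -> : s + i < size v by lia.
have -> : s + (p + i) < size v by lia.
by rewrite H // addnA.
Qed.

Lemma has_overlap_take n w : has_overlap (take n w) -> has_overlap w.
Proof. by move/(@has_overlap_cat [::] _ (drop n w)); rewrite cat_take_drop. Qed.

Lemma has_overlap_drop n w : has_overlap (drop n w) -> has_overlap w.
Proof.
by move/(@has_overlap_cat (take n w) _ [::]); rewrite cats0 cat_take_drop.
Qed.

Lemma has_overlap_rev w : has_overlap (rev w) = has_overlap w.
Proof.
suff imp u : has_overlap u -> has_overlap (rev u).
  by apply/idP/idP => /imp //; rewrite revK.
case/has_overlapP => s [p [p0 pw H]]; apply/has_overlapP.
exists (size u - (s + 2 * p).+1), p; rewrite size_rev; split=> //; first by lia.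
move=> i Hi; rewrite !nth_rev; try lia.
have := H (p - i) (leq_subr _ _).
rewrite (_ : size u - _ = s + p + (p - i)); last by lia.
by rewrite (_ : size u - _ = s + (p - i)); last by lia.
Qed.

Lemma has_overlap_negb w : has_overlap (map negb w) = has_overlap w.
Proof.
suff imp u : has_overlap u -> has_overlap (map negb u).
  by apply/idP/idP => /imp //; rewrite (mapK negbK).
case/has_overlapP => s [p [p0 pw H]]; apply/has_overlapP.
exists s, p; rewrite size_map; split=> // i Hi.
by rewrite !(nth_map false) ?H //; lia.
Qed.

(** Words grow leftwards from overlap-free tails, so only prefixes need testing, and the lists stay
    small enough for exhaustive checks by [vm_compute]. *)
Fixpoint of_words n : seq bitseq :=
  if n is n'.+1 then
    let s := of_words n' in
    [seq w <- map (cons true) s ++ map (cons false) s | ~~ overlap_prefix w]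
  else [:: [::]].

Lemma of_wordsP n w :
  reflect (size w = n /\ ~~ has_overlap w) (w \in of_words n).
Proof.
elim: n w => [|n IHn] w.
  by rewrite inE; apply: (iffP eqP) => [->|[/size0nil]].
rewrite /= mem_filter mem_cat; apply: (iffP andP) => [[Hp /orP []]|].
- by case/mapP => u /IHn [su Hu] ew; rewrite ew /= in Hp *; rewrite su negb_or Hp.
- by case/mapP => u /IHn [su Hu] ew; rewrite ew /= in Hp *; rewrite su negb_or Hp.
case: w => [|a w] [] //= [sw]; rewrite negb_or => /andP [Hp Hw]; split=> //.
have {}Hw : w \in of_words n by apply/IHn.
by apply/orP; case: a {Hp}; [left|right]; apply: map_f.
Qed.

Lemma all_of_words P n w :
  all P (of_words n) -> size w = n -> ~~ has_overlap w -> P w.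
Proof. by move/allP => H sw Hw; apply/H/of_wordsP. Qed.

(** * The morphism [a |-> a (~~ a)] *)

Fixpoint mu w : bitseq := if w is a :: w' then [:: a, ~~ a & mu w'] else [::].

(** This is [mu] on infinite sequences: positions [2 * k] and [2 * k + 1] carry the block of
    [f k]. *)
Definition mu_fun f i := f i./2 (+) odd i.

Lemma size_mu w : size (mu w) = 2 * size w.
Proof. by elim: w => //= a w ->; lia. Qed.

Lemma nth_mu w i : i < 2 * size w -> nth false (mu w) i = mu_fun (nth false w) i.
Proof.
elim: w i => [|a w IHw] [|[|i]] //= Hi; rewrite /mu_fun /= ?addbF ?addbT //.
by rewrite IHw /mu_fun ?negbK //; lia.
Qed.

Lemma mu_cat u v : mu (u ++ v) = mu u ++ mu v.
Proof. by elim: u => //= a u ->. Qed.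

Lemma take_mu n w : take (2 * n) (mu w) = mu (take n w).
Proof. by elim: n w => [|n IHn] [|a w] //; rewrite mulnS /= IHn. Qed.

Lemma drop_mu n w : drop (2 * n) (mu w) = mu (drop n w).
Proof. by elim: n w => [|n IHn] [|a w] //; rewrite mulnS /= IHn. Qed.

Lemma rev_mu w : rev (mu w) = mu (map negb (rev w)).
Proof.
elim: w => //= a w IHw.
by rewrite !rev_cons map_rcons -!cats1 mu_cat IHw /= negbK -catA.
Qed.

Lemma mu_mkseq f n : mkseq (mu_fun f) (2 * n) = mu (mkseq f n).
Proof.
apply: (@eq_from_nth _ false); first by rewrite size_mu !size_mkseq.
move=> i; rewrite size_mkseq => Hi.
have Hi2 : i./2 < n by lia.
by rewrite nth_mu ?size_mkseq // nth_mkseq // /mu_fun nth_mkseq.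
Qed.

(* A binary word of odd length cannot alternate cyclically. *)
Lemma odd_overlap f s p :
  odd p -> overlap_at f s p ->
  exists2 i, i < p & f (s + i) = f (s + i).+1 /\ f (s + p + i) = f (s + p + i).+1.
Proof.
move=> op H.
case: (pickP (fun i : 'I_p => f (s + i) == f (s + i).+1)) => [i /eqP Hi|Hn].
  have ip := ltn_ord i; exists i => //; split=> //.
  by rewrite -addnS -!H ?addnS //; lia.
have alt i : i <= p -> f (s + i) = f s (+) odd i.
  elim: i => [|i IHi] Hi; first by rewrite addn0 addbF.
  have := Hn (Ordinal Hi); rewrite /= IHi 1?ltnW // addnS.
  by case: (f (s + i).+1) (f s) (odd i) => [] [] [].
by have := H 0 isT; rewrite !addn0 (alt p) // op; case: (f s).
Qed.

(** An odd period puts a pair of equal adjacent letters at positions of both parities, hence once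
    inside a block. For even [p] the offsets [2 * i] all have the same parity correction, which
    cancels. *)
Lemma mu_overlap f s p :
  0 < p -> overlap_at (mu_fun f) s p ->
  ~~ odd p /\ overlap_at f s./2 p./2.
Proof.
move=> p0 H; have op : ~~ odd p.
  apply/negP=> op; case: (odd_overlap op H) => i ip [].
  have same j : ~~ odd j -> mu_fun f j = mu_fun f j.+1 -> False.
    by rewrite /mu_fun /= uphalf_half => /negbTE -> /=; case: (f _).
  have [oi|oi] := boolP (odd (s + i)); last by move/same => /(_ oi).
  by move=> _ /same; apply; lia.
split=> // i Hi; have := H (2 * i); rewrite /mu_fun.
rewrite (_ : (s + 2 * i)./2 = s./2 + i); last by lia.
rewrite (_ : (s + p + 2 * i)./2 = s./2 + p./2 + i); last by lia.
rewrite (_ : odd (s + p + 2 * i) = odd (s + 2 * i)); last by lia.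
by move=> /(_ _)/addIb; apply; lia.
Qed.

Lemma mu_free w : ~~ has_overlap w -> ~~ has_overlap (mu w).
Proof.
move=> /has_overlapP H; apply/has_overlapP => -[s [p [p0]]].
rewrite size_mu => pw Ho; apply: H.
have [op Hf] : ~~ odd p /\ overlap_at (nth false w) s./2 p./2.
  by apply: mu_overlap => // i Hi; rewrite -!nth_mu ?Ho //; lia.
by exists s./2, p./2; split=> //; lia.
Qed.

(** * Extremal words *)

Definition ins i a w := take i w ++ a :: drop i w.

Definition extremalb w :=
  ~~ has_overlap w &&
  all (fun i => has_overlap (ins i true w) && has_overlap (ins i false w))
      (iota 0 (size w).+1).

Lemma extremalE w :
  extremal_overlap_free w <->
  ~~ has_overlap w /\ forall i a, i <= size w -> has_overlap (ins i a w).
Proof.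
split=> -[Hw H]; split; try exact/overlap_freeE.
  move=> i a Hi; apply/contains_overlapE/H.
  by exists a, (take i w), (drop i w); rewrite cat_take_drop.
move=> _ [a [u [v [Ew ->]]]]; apply/contains_overlapE.
have := H (size u) a; rewrite -Ew size_cat leq_addr /ins.
by rewrite take_size_cat // drop_size_cat //; apply.
Qed.

Lemma extremalP w : reflect (extremal_overlap_free w) (extremalb w).
Proof.
apply: (iffP andP) => [[Hw /allP H]|/extremalE [Hw H]].
  apply/extremalE; split=> // i a Hi.
  have /H /andP : i \in iota 0 (size w).+1 by rewrite mem_iota.
  by case: a; case.
split=> //; apply/allP => i; rewrite mem_iota => Hi.
by rewrite !H.
Qed.

Lemma rev_ins i a w :
  i <= size w -> rev (ins i a w) = ins (size w - i) a (rev w).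
Proof.
move=> Hi; rewrite /ins rev_cat rev_cons cat_rcons.
by rewrite take_rev drop_rev subKn.
Qed.

Lemma ins_cat i a u v w :
  i <= size v -> ins (size u + i) a (u ++ v ++ w) = u ++ ins i a v ++ w.
Proof.
move=> Hi; rewrite /ins !take_cat !drop_cat !ltnNge !leq_addr /= !addKn.
by case: ltngtP Hi => // [Hi _|-> _];
  rewrite ?subnn ?take0 ?drop0 ?take_size ?drop_size ?cats0 -!catA //= -?catA.
Qed.

(* Inserting [e] in front of [w] is exempted, because the overlap it creates
   may be longer than the window [w]. *)
Definition dead_start e w :=
  all (fun i => all (fun a => has_overlap (ins i a w) || (ins i a w == e :: w))
                    [:: true; false])
      (iota 0 8).

(** An overlap found inside the window survives in the whole word; the exempted insertions all
    produce [e :: w], which is handled by hypothesis. *)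
Lemma dead_startP e n w :
  7 <= n -> n <= size w -> dead_start e (take n w) -> has_overlap (e :: w) ->
  forall i a, i <= 7 -> has_overlap (ins i a w).
Proof.
move=> n7 nw /allP H He i a Hi.
have {H} /allP H : all (fun a => has_overlap (ins i a (take n w)) ||
    (ins i a (take n w) == e :: take n w)) [:: true; false].
  by apply: H; rewrite mem_iota; lia.
have Ew : ins i a w = ins i a (take n w) ++ drop n w.
  rewrite -{1}(cat_take_drop n w) -[take n w ++ _]cat0s.
  by rewrite (@ins_cat i a [::]) // size_takel; lia.
have /H /orP [] : a \in [:: true; false] by case: a {H Ew}.
  by move/(@has_overlap_cat [::] _ (drop n w)); rewrite Ew.
by move/eqP=> E; rewrite Ew E /= cat_take_drop.
Qed.

(** Six blocks suffice: for every overlap-free [Y] of length 6, an insertion at gap 6 or 7 of [mu Y]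
    already creates an overlap there. Two gaps serve both parities of [i] when [j] is even. *)
Lemma ins_middle w Y i j a :
  size Y = 6 -> ~~ has_overlap Y -> take 12 (drop j w) = mu Y ->
  j + 6 <= i <= j + 7 -> j <= size w -> has_overlap (ins i a w).
Proof.
move=> sY hY E Hi jw.
rewrite -(cat_take_drop j w) -(cat_take_drop 12 (drop j w)) E.
rewrite -[i](@subnKC (size (take j w))) size_takel //; last by lia.
rewrite -{1}(size_takel jw) ins_cat; last by rewrite size_mu sY; lia.
apply: has_overlap_cat.
have : all (fun Y => all (fun i => has_overlap (ins i true (mu Y)) &&
    has_overlap (ins i false (mu Y))) [:: 6; 7]) (of_words 6) by vm_compute.
move/all_of_words => /(_ Y sY hY) /and3P [/andP [H6t H6f] /andP [H7t H7f] _].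
have [->|->] : i - j = 6 \/ i - j = 7 by lia.
  by case: a.
by case: a.
Qed.

(* Far from the ends an insertion breaks the pairing of the letters into blocks
   of [mu], so only the two ends need individual care. *)
Lemma extremal_of_windows w :
  ~~ has_overlap w ->
  (forall j, 0 < j -> 2 * j + 13 <= size w -> exists Y,
     [/\ size Y = 6, ~~ has_overlap Y & take 12 (drop (2 * j) w) = mu Y]) ->
  (forall i a, i <= 7 -> has_overlap (ins i a w)) ->
  (forall i a, i <= 7 -> has_overlap (ins i a (rev w))) ->
  extremal_overlap_free w.
Proof.
move=> hw mid left right; apply/extremalE; split=> // i a iw.
have [|i7] := leqP i 7; first exact: left.
have [si|si] := leqP (size w - i) 7.
  by rewrite -has_overlap_rev rev_ins //; apply: right.
(* The window starts at an even position and has gap [i] at offset 6 or 7. The bounds on [j] spare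
   the first and the last letter, which may have been flipped. *)
have [||Y [sY hY E]] := mid (i./2 - 3); [lia|lia|].
by apply: (ins_middle a sY hY E); lia.
Qed.

(** * Trimming and flipping the ends of [mu Y] *)

Variant end_op := Keep | Trim | Flip.

Definition lop o w :=
  match o with
  | Keep => w
  | Trim => behead w
  | Flip => if w is a :: w' then ~~ a :: w' else [::]
  end.

Definition rop o w := rev (lop o (rev w)).

Definition pre_aaba w :=
  if w is [:: a, b, c, d & _] then [&& a == b, c == ~~ a & d == a] else false.

Lemma pre_aaba_inv w : pre_aaba w -> exists a u, w = [:: a, a, ~~ a, a & u].
Proof.
by case: w => [|a [|b [|c [|d u]]]] //= /and3P [/eqP <- /eqP -> /eqP ->]; exists a, u.
Qed.

(** A new overlap must start at the first letter. An even period copies the equal letters at 0 and 1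
    into a block; an odd period of at least 5 does so with those at 3 and 4; periods 1 and 3
    contradict the seven given letters. *)
Lemma flip_free w a u :
  w = [:: a, a, ~~ a, a, a, ~~ a, ~~ a & u] ->
  (forall i, ~~ odd i -> 0 < i -> i + 2 < size w ->
     nth false w i <> nth false w i.+1) ->
  ~~ has_overlap (behead w) -> ~~ has_overlap w.
Proof.
move=> Ew pair hw; apply/negP => /has_overlapP [[|s] [p [p0 pw H]]]; last first.
  case/has_overlapP: hw; exists s, p; rewrite {}Ew /= in pw H *.
  by split.
have H0 := H 0 isT; have H1 := H 1 p0; rewrite !add0n addn0 addn1 in H0 H1.
have [op|op] := boolP (odd p); last first.
  by case: (pair p op p0); [lia | rewrite -H0 -H1 Ew].
have [p4|p4] := leqP 5 p.
  case: (pair (p + 3)); [lia|lia|lia|].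
  by rewrite -addnS -(H 3) -?(H 4) ?Ew //; lia.
have [Ep|Ep] : p = 1 \/ p = 3 by lia.
  by have := H1; rewrite Ep Ew /=; case: (a).
by have := H 3; rewrite Ep Ew /= => /(_ isT); case: (a).
Qed.

(** The last letter of [w] is left free because the right end may already have been modified. *)
Lemma flip_mu_free Y w :
  pre_aaba Y -> 8 <= size w <= 2 * size Y ->
  (forall i, i.+1 < size w -> nth false w i = nth false (mu Y) i) ->
  ~~ has_overlap (behead w) -> ~~ has_overlap (lop Flip w).
Proof.
move=> /pre_aaba_inv [a [u EY]] sw wY hw.
have Et : take 7 w = take 7 (mu Y).
  have st : size (take 7 w) = 7 by rewrite size_takel //; lia.
  apply: (@eq_from_nth _ false); first by rewrite st size_takel // size_mu; lia.
  by move=> i; rewrite st => Hi; rewrite !nth_take // wY //; lia.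
have Ew : w = [:: a, ~~ a, a, ~~ a, ~~ a, a, a & drop 7 w].
  by rewrite -{1}(cat_take_drop 7 w) Et EY /= negbK.
apply: (@flip_free _ (~~ a) (drop 7 w)); first by rewrite negbK {1}Ew.
  move=> i oi i0; rewrite (_ : size _ = size w); last by rewrite Ew.
  move=> Hi; have Fw j : 0 < j -> nth false (lop Flip w) j = nth false w j.
    by case: j => // j _; rewrite Ew.
  rewrite !Fw // !wY //; try lia.
  rewrite !nth_mu /mu_fun /=; try lia.
  by rewrite uphalf_half (negbTE oi); case: (nth false Y _).
by move: hw; rewrite Ew.
Qed.

Lemma lop_free o Y w :
  ~~ has_overlap w -> 8 <= size w <= 2 * size Y ->
  (forall i, i.+1 < size w -> nth false w i = nth false (mu Y) i) ->
  (o = Flip -> pre_aaba Y) -> ~~ has_overlap (lop o w).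
Proof.
move=> hw sw wY ty.
have hb : ~~ has_overlap (behead w).
  by apply: contra hw; rewrite -drop1; apply: has_overlap_drop.
by case: o ty => //= ty; apply: (@flip_mu_free Y) => //; apply: ty.
Qed.

Definition cut o := if o is Trim then 1 else 0.

Lemma size_lop o w : size (lop o w) = size w - cut o.
Proof. by case: o w => [||] [|a w] //=; rewrite ?subn0 ?subn1. Qed.

Lemma size_rop o w : size (rop o w) = size w - cut o.
Proof. by rewrite size_rev size_lop size_rev. Qed.

Lemma take_rop o n w : n < size w -> take n (rop o w) = take n w.
Proof.
case/lastP: w => // w a; rewrite size_rcons ltnS /rop rev_rcons => nw.
have tr b : take n (rcons w b) = take n w by rewrite -cats1 takel_cat.
by case: o; rewrite [lop _ _]/= ?rev_cons ?revK ?tr.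
Qed.

Lemma nth_rop o i w : i.+1 < size w -> nth false (rop o w) i = nth false w i.
Proof. by move=> Hi; rewrite -(nth_take _ (ltnSn i)) take_rop // nth_take. Qed.

(** * Recursive construction of overlap-free words with prescribed ends *)

Definition step l r Y := lop l (rop r (mu Y)).

Lemma rev_step l r Y : rev (step l r Y) = rop l (lop r (mu (map negb (rev Y)))).
Proof. by rewrite /step /rop rev_mu. Qed.

Lemma size_step l r Y : size (step l r Y) = 2 * size Y - cut r - cut l.
Proof. by rewrite size_lop size_rop size_mu. Qed.

(* The first letters of a word up to complementation. *)
Variant shape := AABA | ABB | AB | AAB.

Definition shaped t w :=
  match t, w with
  | AABA, _ => pre_aaba w
  | ABB, [:: a, b, c & _] => (b == ~~ a) && (c == b)
  | AB, [:: a, b & _] => b == ~~ a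
  | AAB, [:: a, b, c & _] => (b == a) && (c == ~~ a)
  | _, _ => false
  end.

(* [leads o t t']: if [Y] has shape [t], then applying [o] to [mu Y] yields shape
   [t']. *)
Definition leads o t t' :=
  match o, t, t' with
  | Flip, AABA, (AABA | AAB) | Trim, ABB, AABA | Keep, AB, ABB
  | Keep, _, AB | Trim, AAB, AB | Trim, AB, AAB => true
  | _, _, _ => false
  end.

Lemma shaped_map t w : shaped t (map negb w) = shaped t w.
Proof.
by case: t; case: w => [|a [|b [|c [|d w]]]] //=;
  case: a; case: b => //; case: c => //; case: d.
Qed.

Lemma shaped_take t u v : take 4 u = take 4 v -> shaped t u = shaped t v.
Proof.
have tk w : shaped t w = shaped t (take 4 w).
  by case: w => [|a [|b [|c [|d w]]]] //=; rewrite take0.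
by move=> E; rewrite tk E -tk.
Qed.

Lemma leads_shaped o t t' Y w :
  leads o t t' -> shaped t Y -> take 6 w = take 6 (mu Y) -> shaped t' (lop o w).
Proof.
move=> lo tY E; rewrite -(cat_take_drop 6 w) E; move: (drop 6 w) => {E}w.
case: Y tY => [|a [|b [|c [|d Y]]]] /=; case: t lo => //=; case: o => //=; case: t' => //= _.
all: try by case: a => //; case: b => //; case: c => //; case: d.
Qed.

(** The right end is treated first, as the left end of the reversal, which is [mu] of the
    complemented reversal of [Y]. *)
Lemma step_free l r Y :
  ~~ has_overlap Y -> 5 <= size Y -> (l = Flip -> pre_aaba Y) ->
  (r = Flip -> pre_aaba (rev Y)) -> ~~ has_overlap (step l r Y).
Proof.
move=> hY sY tl tr; have sr := size_rop r (mu Y); rewrite size_mu in sr.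
have cr : cut r <= 1 by case: (r).
have hr : ~~ has_overlap (rop r (mu Y)).
  rewrite /rop has_overlap_rev rev_mu.
  apply: (@lop_free _ (map negb (rev Y))) => //.
  - by rewrite -rev_mu has_overlap_rev mu_free.
  - by rewrite size_mu size_map size_rev; lia.
  - by move/tr; apply: etrans (shaped_map AABA _).
apply: (@lop_free _ Y) => //; first by rewrite sr; lia.
by move=> i Hi; rewrite nth_rop // size_mu; lia.
Qed.

Definition typed t1 t2 m := exists Y,
  [/\ size Y = m, ~~ has_overlap Y, shaped t1 Y & shaped t2 (rev Y)].

Lemma typed_sym t1 t2 m : typed t1 t2 m -> typed t2 t1 m.
Proof.
by case=> Y [sY hY H1 H2]; exists (rev Y); split; rewrite ?size_rev ?has_overlap_rev ?revK.
Qed.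

(** The bound on [m] keeps the letters that decide the shape at one end clear of the operation at
    the other. *)
Lemma typed_step l r s1 s2 t1 t2 m :
  leads l s1 t1 -> leads r s2 t2 -> 5 <= m -> typed s1 s2 m ->
  typed t1 t2 (2 * m - cut r - cut l).
Proof.
move=> ll lr m5 [Y [sY hY H1 H2]]; exists (step l r Y).
have flip o s t u : leads o s t -> shaped s u -> o = Flip -> pre_aaba u.
  by move=> lo su Eo; move: lo su; rewrite Eo; case: s => //; case: t.
have c1 o : cut o <= 1 by case: o.
have := c1 r; have := c1 l => cl cr.
split.
- by rewrite size_step sY.
- by apply: step_free; rewrite ?sY //; [apply: flip ll _|apply: flip lr _].
- apply: (leads_shaped ll H1); rewrite take_rop // size_mu; lia.
rewrite rev_step (@shaped_take _ _ (lop r (mu (map negb (rev Y))))).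
  by apply: (leads_shaped lr _ erefl); rewrite shaped_map.
by rewrite take_rop // size_lop size_mu size_map size_rev; lia.
Qed.

Definition typedb t1 t2 m :=
  has (fun Y => shaped t1 Y && shaped t2 (rev Y)) (of_words m).

Lemma typedP t1 t2 m : typedb t1 t2 m -> typed t1 t2 m.
Proof. by case/hasP => Y /of_wordsP [sY hY] /andP [H1 H2]; exists Y. Qed.

(** The five pairs of shapes feed each other, so one induction carries them all. Odd lengths trim
    one end, even lengths none or both. Lengths 10 to 19 are enumerated, since from 20 on the halves
    are at least 10. *)
Lemma typed_mixed m :
  10 <= m ->
  [/\ typed AABA ABB m, typed AABA AB m, typed AABA AAB m, typed ABB AB m
    & typed AB AAB m].
Proof.
elim/ltn_ind: m => m IHm m10; have [m20|m20] := ltnP m 20.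
  have : all (fun m => [&& typedb AABA ABB m, typedb AABA AB m, typedb AABA AAB m,
      typedb ABB AB m & typedb AB AAB m]) (iota 10 10) by vm_compute.
  move/allP => /(_ m); rewrite mem_iota m10 m20 => /(_ isT).
  by case/and5P; split; apply: typedP.
have step_m l r s1 s2 t1 t2 n : leads l s1 t1 -> leads r s2 t2 -> 5 <= n ->
    m = 2 * n - cut r - cut l -> typed s1 s2 n -> typed t1 t2 m.
  by move=> ll lr n5 ->; apply: typed_step.
have [om|om] := boolP (odd m).
  have n10 : 10 <= m.+1./2 by lia.
  have Em : m = 2 * m.+1./2 - 1 - 0 by lia.
  have Em' : m = 2 * m.+1./2 - 0 - 1 by lia.
  have n5 : 5 <= m.+1./2 by lia.
  have [|_ H02 H04 H12 H24] := IHm m.+1./2 _ n10; first by lia.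
  split.
  - exact: (step_m Trim Keep _ _ _ _ _ _ _ n5 Em' H12).
  - exact: (step_m Flip Trim _ _ _ _ _ _ _ n5 Em H04).
  - exact: (step_m Flip Trim _ _ _ _ _ _ _ n5 Em H02).
  - exact: (step_m Keep Trim _ _ _ _ _ _ _ n5 Em H24).
  - exact: (step_m Keep Trim _ _ _ _ _ _ _ n5 Em H02).
have n10 : 10 <= m./2 by lia.
have Em : m = 2 * m./2 - 0 - 0 by lia.
have n5 : 5 <= m./2 by lia.
have [|_ H02 _ _ H24] := IHm m./2 _ n10; first by lia.
have Em' : m = 2 * m./2.+1 - 1 - 1 by lia.
have [||_ _ _ H12 _] := IHm m./2.+1; [lia|lia|].
split.
- exact: (step_m Flip Keep _ _ _ _ _ _ _ n5 Em H02).
- exact: (step_m Flip Keep _ _ _ _ _ _ _ n5 Em H02).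
- exact: (step_m Trim Trim _ _ _ _ _ _ _ (leqW n5) Em' H12).
- exact: (step_m Keep Keep _ _ _ _ _ _ _ n5 Em H24).
- exact: (step_m Keep Flip _ _ _ _ _ _ _ n5 Em (typed_sym H02)).
Qed.

(** Odd lengths come from [typed_mixed]. Even lengths flip both ends at half the length, so the one
    base length left open, 16, propagates to its doubles only. *)
Lemma typed_aaba m : 10 <= m -> typed AABA AABA m \/ exists k, m = 2 ^ k.
Proof.
elim/ltn_ind: m => m IHm m10; have [m20|m20] := ltnP m 20.
  have : all (fun m => typedb AABA AABA m || (m == 16)) (iota 10 10) by vm_compute.
  move/allP => /(_ m); rewrite mem_iota m10 m20 => /(_ isT).
  by case/orP => [/typedP|/eqP ->]; [left | right; exists 4].
have [om|om] := boolP (odd m).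
  left; have [|H01 _ _ _ _] := @typed_mixed m.+1./2; first by lia.
  have := @typed_step Flip Trim AABA ABB AABA AABA _ isT isT _ H01.
  by rewrite (_ : _ - _ - _ = m) /=; [apply; lia | lia].
have [||H|[k Ek]] := IHm m./2; [lia|lia| |].
  left; have := @typed_step Flip Flip AABA AABA AABA AABA _ isT isT _ H.
  by rewrite (_ : _ - _ - _ = m) /=; [apply; lia | lia].
by right; exists k.+1; rewrite expnS; lia.
Qed.

(** * Extremal words of even length *)

Lemma take_flip n w : take n (lop Flip w) = lop Flip (take n w).
Proof. by case: w n => [|a w] [|n]. Qed.

(** Both ends look alike up to reversal and complement, so one local claim, about any word with the
    right 14 first letters, serves [w] and [rev w]. *)
Lemma even_extremal m :
  10 <= m -> typed AABA AABA m -> exists w, size w = 2 * m /\ extremal_overlap_free w.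
Proof.
move=> m10 [Y [sY hY H1 H2]]; exists (step Flip Flip Y).
have sw : size (step Flip Flip Y) = 2 * m by rewrite size_step sY /= !subn0.
have left Z : size Z = m -> ~~ has_overlap Z -> pre_aaba Z ->
    forall w, take 14 w = take 14 (lop Flip (mu Z)) -> size w = 2 * m ->
    forall i a, i <= 7 -> has_overlap (ins i a w).
  move=> sZ hZ tZ w Ew sww.
  (* The exempted letter [true] is an arbitrary choice: the second conjunct shows that prepending it
     also fails inside the window. *)
  have : all (fun Z => pre_aaba Z ==> dead_start true (lop Flip (mu Z)) &&
      has_overlap (true :: lop Flip (mu Z))) (of_words 7) by vm_compute.
  have sZ7 : size (take 7 Z) = 7 by rewrite size_takel // sZ; lia.
  have hZ7 : ~~ has_overlap (take 7 Z) by apply: contra hZ; apply: has_overlap_take.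
  have tZ7 : pre_aaba (take 7 Z) by case: (Z) tZ => [|? [|? [|? [|? ?]]]].
  have E7 : lop Flip (mu (take 7 Z)) = take 14 w.
    by rewrite Ew take_flip -(take_mu 7).
  move/all_of_words => /(_ _ sZ7 hZ7); rewrite tZ7 E7 => /andP [dw hw].
  apply: (@dead_startP true 14) => //; first by lia.
  by rewrite -(cat_take_drop 14 w); apply: (@has_overlap_cat [::] (true :: take 14 w)).
split=> //; apply: extremal_of_windows.
- by apply: step_free => //; rewrite sY; lia.
- rewrite sw => j j0 jm; exists (take 6 (drop j Y)); split.
  + by rewrite size_takel // size_drop sY; lia.
  + by apply: contra hY => /has_overlap_take /has_overlap_drop.
  rewrite -(take_mu 6) -drop_mu; apply: (@eq_from_nth _ false).
    by rewrite !size_takel // size_drop ?sw ?size_mu ?sY; lia.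
  move=> i; rewrite size_takel ?size_drop ?sw; last by lia.
  move=> Hi; rewrite !nth_take // !nth_drop /step.
  have -> u k : 0 < k -> nth false (lop Flip u) k = nth false u k.
    by case: u => // ? ? /=; case: k.
    by rewrite nth_rop // size_mu sY; lia.
  by lia.
- apply: (left Y) => //; rewrite /step !take_flip take_rop //.
  by rewrite size_mu sY; lia.
- apply: (left (map negb (rev Y))).
  + by rewrite size_map size_rev.
  + by rewrite has_overlap_negb has_overlap_rev.
  + by have := shaped_map AABA (rev Y); rewrite H2.
  + by rewrite rev_step take_rop // size_lop size_mu size_map size_rev sY /=; lia.
  + by rewrite size_rev.
Qed.

(** * Factors of periodic sequences *)

(** Windows of such a sequence are overlap-free exactly up to length [2 * q]. The condition on [g 1]
    lets [g 0] alone determine an explicit prefix of each iterate under [mu]. *)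
Definition good q g :=
  [/\ 0 < q, g 1 = ~~ g 0, forall i, g (i + q) = g i &
      forall s p, 0 < p < q -> ~ overlap_at g s p].

Lemma good_mu q g : good q g -> good (2 * q) (mu_fun g).
Proof.
case=> q0 _ per noov; split; first by lia.
- by rewrite /mu_fun /=; case: (g 0).
- move=> i; rewrite /mu_fun (_ : (i + 2 * q)./2 = i./2 + q); last by lia.
  by rewrite per; congr (_ (+) _); lia.
move=> s p pq H; have [||op] := @mu_overlap g s p; [lia|done|].
by apply: noov; lia.
Qed.

Lemma good_mu_iter n q g : good q g -> good (q * 2 ^ n) (iter n mu_fun g).
Proof.
move=> H; elim: n => [|n IHn]; first by rewrite muln1.
by rewrite expnS mulnCA; apply: good_mu.
Qed.

(** [odd] is [mu_fun] of the constant sequence [false], which is not itself [good] because its first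
    two letters agree. *)
Lemma good_2 : good 2 odd.
Proof.
split=> // [i|s p ps H]; first by rewrite oddD addbF.
have Ep : p = 1 by lia.
by have := H 0 isT; rewrite Ep !addn0 oddD; case: (odd s).
Qed.

Lemma good_3 : good 3 (fun i => i %% 3 != 0).
Proof.
split=> // [i|s p ps H]; first by rewrite modnDr.
have H0 := H 0 isT; have H1 := H 1 (proj1 (andP ps)); rewrite !addn0 in H0.
have [Ep|Ep] : p = 1 \/ p = 2 by lia.
  by rewrite Ep in H0 H1; lia.
by have := H 2; rewrite Ep in H0 H1 * => /(_ isT); lia.
Qed.

Lemma take_mkseq f k n : k <= n -> take k (mkseq f n) = mkseq f k.
Proof. by move=> kn; rewrite -map_take take_iota (minn_idPl kn). Qed.

Lemma drop_mkseq f k n : drop k (mkseq f n) = mkseq (fun i => f (k + i)) (n - k).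
Proof.
apply: (@eq_from_nth _ false); first by rewrite size_drop !size_mkseq.
by move=> i; rewrite size_drop size_mkseq => Hi; rewrite nth_drop !nth_mkseq //; lia.
Qed.

Definition window f s n := mkseq (fun i => f (s + i)) n.

Lemma window_cons f s n : window f s n.+1 = f s :: window f s.+1 n.
Proof.
rewrite /window /mkseq /= addn0 -[1]addn0 iotaDl -map_comp; congr cons.
by apply: eq_map => i /=; rewrite addnS.
Qed.

Lemma window_rcons f s n : window f s n.+1 = rcons (window f s n) (f (s + n)).
Proof. exact: mkseqS. Qed.

Lemma take_window f s k n : k <= n -> take k (window f s n) = window f s k.
Proof. exact: take_mkseq. Qed.

Lemma drop_window f s k n : drop k (window f s n) = window f (s + k) (n - k).
Proof. by rewrite /window drop_mkseq; apply: eq_mkseq => i; rewrite addnA. Qed.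

Lemma mu_window f s n : mu (window f s n) = window (mu_fun f) (2 * s) (2 * n).
Proof.
rewrite /window -mu_mkseq; apply: eq_mkseq => i; rewrite /mu_fun.
by rewrite (_ : (2 * s + i)./2 = s + i./2) 1?(_ : odd (2 * s + i) = odd i) //; lia.
Qed.

Lemma window_free q g s n :
  good q g -> n <= 2 * q -> ~~ has_overlap (window g s n).
Proof.
case=> _ _ _ noov nq; apply/has_overlapP => -[t [p [p0]]].
rewrite size_mkseq => pn H; apply: (noov (s + t) p); first by lia.
by move=> i Hi; have := H i Hi; rewrite !nth_mkseq ?addnA //; lia.
Qed.

Lemma window_overlap q g s n :
  good q g -> 2 * q < n -> has_overlap (window g s n).
Proof.
case=> q0 _ per _ qn; apply/has_overlapP; exists 0, q; split; rewrite ?size_mkseq //.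
move=> i Hi; rewrite !add0n nth_mkseq; last by lia.
by rewrite nth_mkseq; [rewrite addnCA [q + _]addnC per | lia].
Qed.

(* The first 32 letters of [tower g] depend only on [g 0], and contain around
   position 18 a pattern at whose ends all insertions fail. *)
Definition tower g := iter 4 mu_fun g.

Definition start a := mu (mu (mu (mu [:: a; ~~ a]))).

Lemma good_tower q g : good q g -> good (16 * q) (tower g).
Proof. by rewrite mulnC; apply: (@good_mu_iter 4). Qed.

Lemma window_tower q g s n :
  good q g -> s + n <= 32 -> window (tower g) s n = take n (drop s (start (g 0))).
Proof.
case=> _ g1 _ _ sn; have -> : start (g 0) = window (tower g) 0 32.
  by rewrite /start -g1 -[[:: _; _]]/(window g 0 2) !mu_window.
by rewrite drop_window take_window ?add0n //; lia.
Qed.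

Lemma tower_nth q g k :
  good q g -> k < 32 -> tower g k = nth false (start (g 0)) k.
Proof.
move=> gq Hk; have := @window_tower q g 0 32 gq isT.
rewrite drop0 take_oversize // => <-.
by rewrite nth_mkseq.
Qed.

Lemma window_per q g s n : good q g -> window g (s + 2 * q) n = window g s n.
Proof.
case=> _ _ per _; apply: eq_mkseq => i.
by rewrite mul2n -addnn addnA addnAC per addnAC per.
Qed.

(** As 18 is even, the blocks come from the third iterate, read from position 9. *)
Lemma tower_middle q g j n :
  good q g -> 2 <= q -> 2 * j + 12 <= n -> exists Y,
  [/\ size Y = 6, ~~ has_overlap Y &
      take 12 (drop (2 * j) (window (tower g) 18 n)) = mu Y].
Proof.
move=> gq q2 jn; exists (window (iter 3 mu_fun g) (9 + j) 6); split.
- by rewrite size_mkseq.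
- by apply: window_free (@good_mu_iter 3 q g gq) _; lia.
by rewrite drop_window take_window ?mu_window ?mulnDr //; lia.
Qed.

(** The word is a square of period [16 * q]. Continuing the period beyond an end gives an overlap as
    long as the whole extended word, hence the exempted letters; other insertions near an end fail
    within its 14 letters. *)
Lemma square_extremal q g :
  good q g -> 2 <= q -> exists w, size w = 32 * q /\ extremal_overlap_free w.
Proof.
move=> gq q2; have gG := good_tower gq; set w := window (tower g) 18 (32 * q).
have sw : size w = 32 * q by rewrite size_mkseq.
exists w; split=> //; apply: extremal_of_windows.
- by apply: window_free gG _; lia.
- by rewrite sw => j j0 jw; apply: tower_middle gq q2 _; lia.
- apply: (@dead_startP (tower g 17) 14); rewrite ?sw //; first by lia.
    rewrite take_window ?(window_tower gq) ?(tower_nth gq) //; last by lia.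
    by case: (g 0); vm_compute.
  by rewrite -window_cons; apply: window_overlap gG _; lia.
apply: (@dead_startP (tower g 18) 14); rewrite ?size_rev ?sw //; first by lia.
  (* The last 14 letters start at 4 modulo two periods, hence lie in the known prefix. *)
  rewrite take_rev sw drop_window (_ : 18 + _ = 4 + 2 * (16 * q)); last by lia.
  rewrite (window_per _ _ gG) (_ : _ - _ = 14); last by lia.
  rewrite (window_tower gq) ?(tower_nth gq) //.
  by case: (g 0); vm_compute.
rewrite -rev_rcons has_overlap_rev.
have -> : tower g 18 = tower g (18 + 32 * q).
  by have := @window_per _ _ 18 1 gG; rewrite (_ : 2 * (16 * q) = 32 * q) => [[]|]; rewrite ?addn0 //; lia.
by rewrite -window_rcons; apply: window_overlap gG _; lia.
Qed.

(** Before the flip the window is a single overlap of period [16 * q]; behind its first letter lies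
    an overlap-free square. At the left end every insertion fails locally; at the right end the
    exempted letter continues that square. *)
Lemma odd_extremal q g :
  good q g -> 2 <= q -> exists w, size w = 32 * q + 1 /\ extremal_overlap_free w.
Proof.
move=> gq q2; have gG := good_tower gq.
set v := window (tower g) 18 (32 * q).+1; set w := lop Flip v.
have sv : size v = (32 * q).+1 by rewrite size_mkseq.
have sw : size w = (32 * q).+1 by rewrite size_lop sv.
have Ew : w = ~~ tower g 18 :: window (tower g) 19 (32 * q) by rewrite /w /v window_cons.
have tw : take 14 w = lop Flip (take 14 (drop 18 (start (g 0)))).
  by rewrite take_flip take_window ?(window_tower gq) //; lia.
exists w; split; first by rewrite sw addn1.
apply: extremal_of_windows.
- apply: (@flip_mu_free (window (iter 3 mu_fun g) 9 (16 * q).+1)).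
  + have HG k : iter 3 mu_fun g k = tower g (2 * k).
      by rewrite /tower [iter 4 _ _]iterS; move: (iter 3 _ _) => h; rewrite /mu_fun mul2n doubleK odd_double addbF.
    rewrite (_ : (16 * q).+1 = (16 * q - 3).+4); last by lia.
    move: (iter 3 mu_fun g) HG => h HG; rewrite !window_cons [pre_aaba _]/= !HG !(tower_nth gq) //.
    by case: (g 0).
  + by rewrite sv size_mkseq; lia.
  + rewrite mu_window sv => i Hi.
    by rewrite !nth_mkseq //; lia.
  + by rewrite /v window_cons; apply: window_free gG _; lia.
- rewrite sw => j j0 jw.
  have [|Y [sY hY E]] := @tower_middle q g j (32 * q).+1 gq q2; first by lia.
  exists Y; split=> //; rewrite -E -/v Ew /v window_cons.
  by case: j j0 {jw E} => // j _; rewrite mulnS.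
- apply: (@dead_startP true 14); rewrite ?sw //; first by lia.
    by rewrite tw; case: (g 0); vm_compute.
  rewrite -(cat_take_drop 14 w); apply: (@has_overlap_cat [::] (true :: take 14 w)).
  by rewrite tw; case: (g 0); vm_compute.
apply: (@dead_startP (tower g 19) 14); rewrite ?size_rev ?sw //; first by lia.
  have -> : rev w = rop Flip (rev v) by rewrite /rop revK.
  rewrite take_rop ?size_rev ?sv; last by lia.
  rewrite take_rev sv drop_window (_ : 18 + _ = 5 + 2 * (16 * q)); last by lia.
  rewrite (window_per _ _ gG) (_ : _ - _ = 14); last by lia.
  rewrite (window_tower gq) ?(tower_nth gq) //.
  by case: (g 0); vm_compute.
rewrite -rev_rcons has_overlap_rev Ew rcons_cons.
have -> : tower g 19 = tower g (19 + 32 * q).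
  by have := @window_per _ _ 19 1 gG; rewrite (_ : 2 * (16 * q) = 32 * q) => [[]|]; rewrite ?addn0 //; lia.
rewrite -window_rcons -cat1s -[window _ _ _]cats0; apply: has_overlap_cat.
by apply: window_overlap gG _; lia.
Qed.

(** * Pairings of overlap-free words *)

Lemma alternating_overlap w s :
  s + 4 < size w ->
  (forall i, i < 4 -> nth false w (s + i) != nth false w (s + i).+1) ->
  has_overlap w.
Proof.
move=> sw H; apply/has_overlapP; exists s, 2; split=> //.
move=> i i2; rewrite (_ : s + 2 + i = (s + i).+2); last by lia.
have H1 : i < 4 by lia.
have H2 : i.+1 < 4 by lia.
move: (H _ H1) (H _ H2); rewrite addnS.
by case: (nth _ _ _) (nth _ _ _) (nth _ _ _) => [] [] [].
Qed.

(* The blocks [w_i w_(i+1)] with [odd i = r] are images of letters, except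
   possibly within two letters of the ends. *)
Definition paired r w := forall i,
  2 <= i -> i + 4 <= size w -> odd i = r -> nth false w i != nth false w i.+1.

(** Length 10 is enumerated, then letters are prepended. The pairings of the first ten letters and
    of the tail have the same parity, for otherwise letters 3 to 7 alternate and form an overlap. *)
Lemma exists_paired w : ~~ has_overlap w -> 10 <= size w -> exists r, paired r w.
Proof.
elim: w => // a w IHw hw sw.
have short u : ~~ has_overlap u -> size u = 10 -> exists r, paired r u.
  move=> hu su; pose P r u := all (fun i => (odd i == r) ==>
    (nth false u i != nth false u i.+1)) (iota 2 5).
  have : all (fun u => P true u || P false u) (of_words 10) by vm_compute.
  move/all_of_words => /(_ u su hu) H.
  have [r /allP Hr] : exists r, P r u by case/orP: H; eexists; eassumption.
  exists r => i i2 isz oi; have := Hr i; rewrite mem_iota oi eqxx /=.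
  by apply; lia.
have [w10|w10] := leqP 10 (size w); last by apply: short => //=; move: sw => /=; lia.
have hw' : ~~ has_overlap w.
  by apply: contra hw => H; rewrite /= H orbT.
have [r Hr] := IHw hw' w10.
have ht : ~~ has_overlap (take 10 (a :: w)) by apply: contra hw; apply: has_overlap_take.
have st : size (take 10 (a :: w)) = 10 by rewrite size_takel.
have [r' Hr'] := short _ ht st.
have {}Hr' i : 2 <= i -> i <= 6 -> odd i = r' ->
    nth false (a :: w) i != nth false (a :: w) i.+1.
  move=> i2 i6 oi; have i10 : i.+1 < 10 by lia.
  rewrite -(nth_take _ i10) -(nth_take _ (ltnW i10)).
  by apply: Hr' => //; rewrite st; lia.
have {}Hr i : 3 <= i -> i + 4 <= (size w).+1 -> odd i = ~~ r ->
    nth false (a :: w) i != nth false (a :: w) i.+1.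
  case: i => // i i2 i4 oi; apply: Hr; [lia|lia|].
  by move: oi; rewrite /=; case: (odd i) (r) => [] [].
have [Er|Er] := eqVneq r' (~~ r); last first.
  have : has_overlap (a :: w); last by rewrite (negbTE hw).
  apply: (@alternating_overlap _ 3); first by rewrite /=; lia.
  move=> i i4; have [oi|oi] := boolP (odd (3 + i) == r').
    by apply: Hr'; [lia|lia|apply/eqP].
  by apply: Hr; [lia|lia|move: oi Er; case: (odd _) (r) (r') => [] [] []].
exists r' => i i2 isz oi; have [i3|i3] := leqP 3 i.
  by apply: Hr => //; rewrite -Er.
by apply: Hr' => //; lia.
Qed.

(** * Overlap-free squares *)

Definition overlap_free_square p := exists v,
  [/\ size v = 2 * p, ~~ has_overlap v &
      forall i, i < p -> nth false v i = nth false v (i + p)].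

(** For odd [p] a shift by [p] swaps parities, so letters 2 to 6 alternate; [9 <= p] keeps the
    shifted pairs away from the right end. For even [p] the shift preserves parity and extends the
    pairing to both ends. *)
Lemma square_half p :
  9 <= p -> overlap_free_square p -> ~~ odd p /\ overlap_free_square p./2.
Proof.
move=> p9 [v [sv hv per]].
have [|r Hr] := exists_paired hv; first by lia.
have op : ~~ odd p.
  apply/negP=> op; move/negP: hv; apply.
  apply: (@alternating_overlap _ 2); first by lia.
  move=> i i4; have [oi|oi] := boolP (odd (2 + i) == r).
    by apply: Hr; [lia|lia|apply/eqP].
  rewrite per ?(per (2 + i).+1); try lia.
  rewrite [(2 + i).+1 + p]addSn; apply: Hr; [lia|lia|].
  by rewrite oddD op; move: oi; case: (odd _) (r) => [] [].
split=> //.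
have {}Hr i : i.+1 < 2 * p -> odd i = r -> nth false v i.+1 = ~~ nth false v i.
  move=> ip oi; suff : nth false v i != nth false v i.+1.
    by case: (nth _ _ _) (nth _ _ _) => [] [].
  have [i2|i2] := ltnP i 2.
    rewrite per ?(per i.+1); try lia.
    by rewrite [i.+1 + p]addSn; apply: Hr; [lia|lia|rewrite oddD (negbTE op) addbF].
  have [i4|i4] := leqP (i + 4) (2 * p); first by apply: Hr; rewrite ?sv.
  rewrite -(subnK (_ : p <= i)); last by lia.
  rewrite -addSn -!per; try lia.
  by apply: Hr; [lia|lia|rewrite oddB ?(negbTE op) ?addbF; lia].
(* These are the first letters of the blocks. For odd [r] the last block sticks out of [v],
   harmlessly: a doubled overlap ends on the first letter of a block. *)
exists (mkseq (fun i => nth false v (2 * i + r)) p); split.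
- by rewrite size_mkseq; lia.
- apply/has_overlapP => -[s [q [q0]]]; rewrite size_mkseq => qp H.
  move/negP: hv; apply; apply/has_overlapP; exists (2 * s + r), (2 * q).
  have H' i : i <= q -> nth false v (2 * (s + i) + r) = nth false v (2 * (s + q + i) + r).
    by move=> iq; have := H i iq; rewrite !nth_mkseq //; lia.
  split; [lia|lia|] => i iq.
  have [oi|oi] := boolP (odd i); last first.
    have := H' i./2; rewrite (_ : 2 * (s + i./2) + r = 2 * s + r + i); last by lia.
    rewrite (_ : 2 * (s + q + i./2) + r = 2 * s + r + 2 * q + i); last by lia.
    by apply; lia.
  have := H' i./2; rewrite (_ : 2 * s + r + i = (2 * (s + i./2) + r).+1); last by lia.
  rewrite (_ : 2 * s + r + 2 * q + i = (2 * (s + q + i./2) + r).+1); last by lia.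
  rewrite !Hr; [|lia|by rewrite oddD mul2n odd_double oddb|lia|by rewrite oddD mul2n odd_double oddb].
  by move=> ->; lia.
- move=> i ip; rewrite !nth_mkseq; [|lia|lia].
  by rewrite per; [congr nth; lia|lia].
Qed.

(** Halving leads down to periods at most 8, of which only 5 and 7 lie outside the two families;
    enumeration excludes them. *)
Lemma overlap_free_square_period p :
  0 < p -> overlap_free_square p -> exists k, p = 2 ^ k \/ p = 3 * 2 ^ k.
Proof.
elim/ltn_ind: p => p IHp p0 sq; have [p9|p9] := leqP 9 p.
  have [op sq2] := square_half p9 sq; have [||k Hk] := IHp p./2 _ _ sq2; [lia|lia|].
  by exists k.+1; rewrite expnS; lia.
have [p5|p5] := boolP (p \in [:: 5; 7]); last first.
  have : p \in [:: 1; 2; 4; 8] ++ [:: 3; 6].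
    by move: p5; rewrite !inE; lia.
  rewrite mem_cat !inE => /orP [/or4P [] /eqP ->|/orP [] /eqP ->];
    [exists 0|exists 1|exists 2|exists 3|exists 0|exists 1]; by [left | right].
case: sq => v [sv hv per].
have : all (fun p => all (fun v => take p v != drop p v) (of_words (2 * p)))
  [:: 5; 7] by vm_compute.
move/allP => /(_ p p5) /all_of_words => /(_ v sv hv) /eqP [].
apply: (@eq_from_nth _ false); first by rewrite size_takel ?size_drop; lia.
move=> i; rewrite size_takel; last by lia.
by move=> ip; rewrite nth_take // nth_drop per // addnC.
Qed.

(* Appending the complement of the last letter completes the last block, so the
   overlap it creates could be moved one letter to the left, unless it already
   starts at the second letter: then [behead w] is a square. *)
Lemma square_of_paired w :
  ~~ has_overlap w -> odd (size w) -> 10 <= size w -> paired false w ->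
  (forall a, has_overlap (rcons w a)) ->
  exists2 p, size w = 2 * p + 1 & overlap_free_square p.
Proof.
move=> hw ow sw pw dead; pose n := size w.
have pair j : 2 <= j -> j + 3 <= n -> ~~ odd j -> nth false w j != nth false w j.+1.
  move=> j2 jn oj; have [j4|j4] := leqP (j + 4) n; first by apply: pw => //; lia.
  (* Only the block at [n - 3] remains; the two blocks before it force it, by enumeration of the
     last seven letters. *)
  have E i : i < 7 -> nth false (take 7 (rev w)) i = nth false w (n - i.+1).
    by move=> i7; rewrite nth_take // nth_rev //; lia.
  have sv : size (take 7 (rev w)) = 7 by rewrite size_takel // size_rev; lia.
  have hv : ~~ has_overlap (take 7 (rev w)).
    by apply: contra hw => /has_overlap_take; rewrite has_overlap_rev.
  have : all (fun v => (nth false v 3 != nth false v 4) &&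
     (nth false v 5 != nth false v 6) ==> (nth false v 1 != nth false v 2))
     (of_words 7) by vm_compute.
  move/all_of_words => /(_ _ sv hv); rewrite !E //.
  have blk i : 2 < i < 7 -> odd i -> nth false w (n - i.+1) != nth false w (n - i.+2).
    move=> i7 oi; rewrite eq_sym (_ : n - i.+1 = (n - i.+2).+1); last by lia.
    by apply: pw; lia.
  rewrite (blk 3) // (blk 5) //= eq_sym.
  by rewrite (_ : n - 3 = j) 1?(_ : n - 2 = j.+1) //; lia.
pose W := rcons w (~~ nth false w n.-1).
have Ww i : i < n -> nth false W i = nth false w i by move=> ni; rewrite nth_rcons ni.
have {}pair j : 2 <= j -> j < n -> ~~ odd j -> nth false W j.+1 = ~~ nth false W j.
  move=> j2 jn oj; have [j3|j3] := leqP (j + 3) n.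
    rewrite !Ww; [|lia|lia].
    by have := pair j j2 j3 oj; case: (nth _ _ _) (nth _ _ _) => [] [].
  have Ej : j.+1 = n by lia.
  by rewrite (Ww j jn) Ej /W nth_rcons ltnn eqxx -[in RHS](eqP (_ : n.-1 == j)) // -Ej.
case/has_overlapP: (dead (~~ nth false w n.-1)) => s [p [p0]].
rewrite -/W size_rcons -/n => sp H.
(* An overlap that avoids the appended letter would lie in [w]. *)
have Es : s + 2 * p = n.
  have [spn|spn] := ltnP (s + 2 * p) n; last by lia.
  case/has_overlapP: hw; exists s, p; split=> // i ip.
  by have := H i ip; rewrite !Ww //; lia.
have neq j : 2 <= j -> j < n -> ~~ odd j -> nth false W j = nth false W j.+1 -> False.
  by move=> j2 jn oj; rewrite (pair j) //; case: (nth _ _ _).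
(* Since [n] is odd, so is [s]; hence even positions within the overlap are at least 2 and start
   blocks of [W]. *)
have op : ~~ odd p.
  apply/negP => op; have [i ip [E1 E2]] := odd_overlap op H.
  have [oi|oi] := boolP (odd (s + i)).
    by apply: neq E2; lia.
  by apply: neq E1; lia.
have [s1|s1] := leqP s 1; last first.
  case/has_overlapP: hw; exists s.-1, p; split=> //; first by lia.
  move=> i ip; rewrite -!Ww; [|lia|lia].
  case: i ip => [_|i ip].
    have := H 0 isT; rewrite !addn0.
    have := pair s.-1; have := pair (s + p).-1; rewrite !prednK; try lia.
    rewrite (_ : s.-1 + p = (s + p).-1); last by lia.
    move=> -> ; [|lia|lia|lia]; move=> ->; [|lia|lia|lia].
    exact: negb_inj.
  rewrite (_ : s.-1 + i.+1 = s + i); last by lia.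
  rewrite (_ : s.-1 + p + i.+1 = s + p + i); last by lia.
  by apply: H; lia.
have {}s1 : s = 1 by lia.
exists p; first by lia.
exists (drop 1 w); split; first by rewrite size_drop -/n; lia.
  by apply: contra hw; apply: has_overlap_drop.
move=> i ip; rewrite !nth_drop -!Ww; [|lia|lia].
by have := H i; rewrite s1 (_ : 1 + p + i = 1 + (i + p)); [apply; lia | lia].
Qed.

(** In odd length, reversal exchanges the parities of block positions, so the unpaired letter may be
    assumed to be the last one. *)
Lemma odd_extremal_square w :
  extremal_overlap_free w -> odd (size w) -> 10 <= size w ->
  exists2 p, size w = 2 * p + 1 & overlap_free_square p.
Proof.
move=> /extremalE [hw dead] ow sw.
have [[] Hr] := exists_paired hw sw; last first.
  apply: square_of_paired => // a; have := dead _ a (leqnn _).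
  by rewrite /ins take_size drop_size cats1.
rewrite -size_rev; apply: square_of_paired; rewrite ?size_rev ?has_overlap_rev //.
  move=> i i2; rewrite size_rev => isz oi; rewrite !nth_rev; try lia.
  rewrite eq_sym (_ : size w - i.+1 = (size w - i.+2).+1); last by lia.
  by apply: Hr; lia.
move=> a; rewrite -has_overlap_rev rev_rcons revK.
by have := dead 0 a isT; rewrite /ins take0 drop0.
Qed.

(** * Sporadic lengths and the classification *)

Definition sporadic : seq bitseq := map (map (eq_op 1))
  [:: [:: 1; 1; 0; 1; 1; 0; 0; 1; 0; 0];
      [:: 0; 0; 1; 0; 0; 1; 1; 0; 0; 1; 0; 0];
      [:: 1; 1; 0; 1; 0; 0; 1; 1; 0; 0; 1; 0; 1; 1; 0; 1; 0; 0; 1; 1; 0; 0; 1; 0; 0];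
      [:: 0; 1; 1; 0; 0; 1; 0; 1; 1; 0; 0; 1; 1; 0; 1; 0; 0; 1; 1; 0; 0; 1; 0; 1; 1; 0; 0; 1; 1; 0; 1; 0];
      [:: 1; 1; 0; 0; 1; 1; 0; 1; 0; 0; 1; 1; 0; 0; 1; 0; 1; 1; 0; 0; 1; 1; 0; 1; 0; 0; 1; 1; 0; 0; 1; 0; 0];
      [:: 1; 1; 0; 1; 0; 0; 1; 0; 1; 1; 0; 0; 1; 1; 0; 1; 0; 0; 1; 1; 0; 0; 1; 0; 1; 1; 0; 1; 0; 0; 1; 0; 1; 1; 0; 0; 1; 1; 0; 1; 0; 0; 1; 1; 0; 0; 1; 0; 0]].

(** These lengths escape the general constructions: 10 and 12 are isolated, and the tower, with
    [2 <= q], starts too late for 32, 33, 25 and 49. *)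
Lemma sporadic_extremal n :
  n \in [:: 10; 12; 25; 32; 33; 49] ->
  exists w, size w = n /\ extremal_overlap_free w.
Proof.
have -> : [:: 10; 12; 25; 32; 33; 49] = map size sporadic by [].
case/mapP => w ws ->; exists w; split=> //; apply/extremalP.
by apply/(allP _ w ws); vm_compute.
Qed.

Lemma short_extremal w :
  extremal_overlap_free w -> size w < 20 -> size w = 10 \/ size w = 12.
Proof.
move=> /extremalP ew sw; have hw := proj1 (andP ew).
have : all (fun n => [|| n == 10, n == 12 | all (predC extremalb) (of_words n)])
  (iota 0 20) by vm_compute.
move/allP => /(_ (size w)); rewrite mem_iota => /(_ sw).
case/or3P => [/eqP|/eqP|/all_of_words H]; [by left | by right |].
by have := H w erefl hw; rewrite /= ew.
Qed.

Theorem theorem1p1 (n : nat) :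
  (exists w : seq Sigma2, size w = n /\ extremal_overlap_free w) <->
  [\/ n = 10 \/ n = 12,
      exists k, 10 <= k /\ n = 2 * k,
      exists k, 5 <= k /\ n = 2 ^ k + 1
    | exists k, 3 <= k /\ n = 3 * 2 ^ k + 1].
Proof.
split=> [[w [sw ew]]|[[->|->]|[k [k10 ->]]|[k [k5 ->]]|[k [k3 ->]]]].
- have {}sw : size (w : bitseq) = n := sw.
  have [n20|n20] := ltnP n 20.
    by constructor 1; rewrite -sw; apply: short_extremal; rewrite ?sw.
  have [on|on] := boolP (odd n); last by constructor 2; exists n./2; lia.
  have [||p] := odd_extremal_square ew; rewrite ?sw //; first by lia.
  move=> Ep sq; have [|k [Ek|Ek]] := overlap_free_square_period _ sq; first by lia.
    (* As [n] is odd and at least 20, the exponent is at least 5 here and at least 3 in the other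
       family. *)
    constructor 3; exists k.+1; split; last by rewrite Ep Ek expnS.
    by case: k Ek => [|[|[|[|k]]]] //=; lia.
  constructor 4; exists k.+1; split; last by rewrite Ep Ek expnS mulnCA.
  by case: k Ek => [|[|k]] //=; lia.
- exact: sporadic_extremal.
- exact: sporadic_extremal.
- have [H|[j Ej]] := typed_aaba k10; first exact: even_extremal k10 H.
  have [Ej4|j5] := leqP j 4.
    case: j Ej4 Ej => [|[|[|[|[|j]]]]] //= _ Ej; try lia.
    by rewrite Ej; exact: sporadic_extremal.
  (* Of the factor 32, 16 comes from the four iterations in [tower] and 2 from the square; the rest
     is the period of an iterate of [odd]. *)
  rewrite (_ : 2 * k = 32 * (2 * 2 ^ (j - 5))).
    by apply: square_extremal (good_mu_iter _ good_2) _; rewrite leq_pmulr ?expn_gt0.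
  by rewrite Ej -{1}(subnKC j5) expnD; lia.
- have [k6|k6] := leqP 6 k; last first.
    have -> : k = 5 by lia.
    exact: sporadic_extremal.
  rewrite (_ : 2 ^ k = 32 * (2 * 2 ^ (k - 6))).
    by apply: odd_extremal (good_mu_iter _ good_2) _; rewrite leq_pmulr ?expn_gt0.
  by rewrite -{1}(subnKC k6) expnD; lia.
have [k5|k5] := leqP 5 k; last first.
  have [->|->] : k = 3 \/ k = 4 by lia.
    exact: sporadic_extremal.
  exact: sporadic_extremal.
rewrite (_ : 3 * 2 ^ k = 32 * (3 * 2 ^ (k - 5))).
  apply: odd_extremal (good_mu_iter _ good_3) _.
  by rewrite (leq_trans (isT : 2 <= 3)) ?leq_pmulr ?expn_gt0.
by rewrite -{1}(subnKC k5) expnD; lia.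
Qed.
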